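(* Let $G=(V,\sigma,\mu)$ be a non-trivial fuzzy graph of size $q$. Then $\gamma_{snR}(G)=2q$ if and only if all edges of $G$ are strong and each vertex of $G$ is either an isolated vertex or has a unique strong neighbor.
   Context: A fuzzy graph $G=(V,\sigma,\mu)$ consists of a finite nonempty set $V$, a function $\sigma:V\to[0,1]$, and a symmetric function $\mu:V\times V\to[0,1]$ with $\mu(x,x)=0$ and $\mu(x,y)\le \min\{\sigma(x),\sigma(y)\}$ for all $x,y\in V$. An edge is an unordered pair $(u,v)$ of distinct vertices with $\mu(u,v)>0$, and $\mu(u,v)$ is its weight. $G$ is non-trivial if it has at least one edge; its size $q$ is the sum of the weights of all its edges, each edge counted once. A vertex $u$ is isolated if $\mu(u,v)=0$ for all $v\ne u$. The strength of a path $x_0,x_1,\ldots,x_m$ (with every $\mu(x_{i-1},x_i)>0$) is $\min_i \mu(x_{i-1},x_i)$, and $CONN_G(u,v)$ is the maximum strength of all $u$–$v$ paths. An edge $(u,v)$ is strong if $\mu(u,v)=CONN_G(u,v)$; then $u,v$ are strong neighbors. $N_s(u)$ is the set of strong neighbors of $u$. Put $\mu_s(u)=\min\{\mu(u,v):v\in N_s(u)\}$, with $\mu_s(u)=0$ if $N_s(u)=\emptyset$. A strong-neighbors Roman dominating function (SNRDF) on $G$ is a function $f:V\to\{0,1,2\}$ such that every $u$ with $f(u)=0$ has some $v\in N_s(u)$ with $f(v)=2$. Its weight is $w(f)=\sum_{u\in V}f(u)\mu_s(u)$, and $\gamma_{snR}(G)$ is the minimum weight of an SNRDF on $G$. *)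

(* Defs.v *)
From mathcomp Require Import all_boot all_order all_algebra.
From mathcomp Require Import reals.

Set Implicit Arguments.
Unset Strict Implicit.
Unset Printing Implicit Defensive.

Import Order.TTheory GRing.Theory Num.Theory.
Local Open Scope ring_scope.

Record fuzzyGraph (R : realType) (V : finType) := FuzzyGraph {
  sigma : V -> R;
  mu : V -> V -> R;
  vertices_gt0 : (0 < #|V|)%N;
  sigma_itv : forall x, 0 <= sigma x <= 1;
  mu_itv : forall x y, 0 <= mu x y <= 1;
  mu_sym : forall x y, mu x y = mu y x;
  mu_irr : forall x, mu x x = 0;
  mu_le_sigma : forall x y, mu x y <= Num.min (sigma x) (sigma y)
}.

Section FuzzyGraphNotions.
Variables (R : realType) (V : finType) (G : fuzzyGraph R V).
Implicit Types (u v : V) (p : seq V).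

Definition is_edge u v : bool := (u != v) && (0 < mu G u v).

Definition nontrivial : Prop := exists u v, is_edge u v.

(* Comparing ranks selects one orientation of each unordered pair. *)
Definition fsize : R :=
  \sum_u \sum_(v | (enum_rank u < enum_rank v)%N && is_edge u v) mu G u v.

Definition isolated u : Prop := forall v, v != u -> mu G u v = 0.

(* The path u, p_0, p_1, ...: as is usual, its vertices are distinct. *)
Definition is_path u v p : bool :=
  [&& uniq (u :: p), path (fun x y => 0 < mu G x y) u p & last u p == v].

(* 1 bounds all edge weights, so it is neutral for the minimum. *)
Definition strength u p : R := \big[Num.min/1]_(w <- pairmap (mu G) u p) w.

(* The vertices of a path being distinct, its length is less than #|V|. The
   value is 0 if no path joins u and v. *)
Definition CONN u v : R :=
  \big[Num.max/0]_(n < #|V|)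
    \big[Num.max/0]_(p : n.-tuple V | is_path u v p) strength u p.

Definition strong_edge u v : bool := is_edge u v && (mu G u v == CONN u v).

Definition Ns u : {set V} := [set v | strong_edge u v].

Definition mu_s u : R :=
  if Ns u == set0 then 0 else \big[Num.min/1]_(v in Ns u) mu G u v.

Definition is_SNRDF (f : {ffun V -> 'I_3}) : bool :=
  [forall u, (f u == 0%N :> nat) ==> [exists v in Ns u, f v == 2%N :> nat]].

Definition weight (f : {ffun V -> 'I_3}) : R := \sum_u (f u)%:R * mu_s u.

Definition one_fun : {ffun V -> 'I_3} := [ffun=> Ordinal (isT : (1 < 3)%N)].

Lemma is_SNRDF_one : is_SNRDF one_fun.
Proof. by apply/forallP => u; rewrite ffunE. Qed.

(* one_fun only witnesses that there is an SNRDF. *)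
Definition gamma_snR : R :=
  weight [arg min_(f < one_fun | is_SNRDF f) weight f]%O.

Lemma gamma_snRP :
  (exists2 f, is_SNRDF f & gamma_snR = weight f) /\
  (forall f, is_SNRDF f -> gamma_snR <= weight f).
Proof.
rewrite /gamma_snR; case: arg_minP; first exact: is_SNRDF_one.
by move=> f Hf le_f; split=> //; exists f.
Qed.

End FuzzyGraphNotions.

(* Main.v *)
(** Write d(u) for the sum of mu(u,v) over all v, so that 2q is the sum of the
    d(u). Since mu_s(u) is at most the weight of any strong edge at u (and is 0 if
    there is none), mu_s(u) <= d(u), with equality for non-isolated u exactly
    when u has a single incident edge and this edge is strong. The constant
    function 1 gives gamma_snR <= sum of mu_s(u) <= 2q, so gamma_snR = 2q forces
    equality at every vertex. Conversely, if the edges form a matching of strong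
    edges, every SNRDF f has f(u) + f(v) >= 2 on each edge, and summing over
    ordered pairs gives w(f) >= 2q. *)
Require Import Defs.
From mathcomp Require Import all_boot all_order all_algebra.
From mathcomp Require Import reals.
Local Open Scope ring_scope.
Import Order.TTheory GRing.Theory Num.Theory.

Section FuzzyGraphTheory.
Context {R : realType} {V : finType}.
Variable G : fuzzyGraph R V.
Implicit Types u v : V.

Definition degree u : R := \sum_v mu G u v.

Lemma mu_ge0 u v : 0 <= mu G u v.
Proof. by case/andP: (mu_itv G u v). Qed.

Lemma mu_le1 u v : mu G u v <= 1.
Proof. by case/andP: (mu_itv G u v). Qed.

Lemma is_edgeE u v : is_edge G u v = (0 < mu G u v).
Proof.
by rewrite /is_edge; case: (eqVneq u v) => //= ->; rewrite mu_irr ltxx.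
Qed.

Lemma strong_edge_gt0 u v : strong_edge G u v -> 0 < mu G u v.
Proof. by case/andP; rewrite is_edgeE. Qed.

Lemma mu_le_degree u v : mu G u v <= degree u.
Proof.
by rewrite /degree (bigD1 v) //= lerDl sumr_ge0 // => w _; apply: mu_ge0.
Qed.

(** By symmetry of [mu], [fsize] is also the sum over the reversed orientation; the two orientations
    together cover every ordered pair off the diagonal, where [mu] vanishes. *)
Lemma mulr2_fsize : 2 * fsize G = \sum_u degree u.
Proof.
have fsizeE : fsize G =
    \sum_u \sum_(v | (enum_rank u < enum_rank v)%N) mu G u v.
  apply: eq_bigr => u _; rewrite [RHS]big_mkcond [LHS]big_mkcond /=.
  apply: eq_bigr => v _; rewrite is_edgeE; case: ltnP => //= _.
  by case: ltgtP (mu_ge0 u v).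
have fsizeE' : fsize G =
    \sum_u \sum_(v | (enum_rank v < enum_rank u)%N) mu G u v.
  rewrite fsizeE (exchange_big_dep xpredT) //=.
  by apply: eq_bigr => u _; apply: eq_bigr => v _; apply: mu_sym.
rewrite mulr_natl mulr2n {1}fsizeE fsizeE' -big_split /=.
apply: eq_bigr => u _; rewrite /degree [RHS](bigD1 u) //= mu_irr add0r.
rewrite [RHS](bigID (fun v => (enum_rank u < enum_rank v)%N)) /=.
congr (_ + _); apply: eq_bigl => v; rewrite -(inj_eq enum_rank_inj) -val_eqE /=;
  by case: ltngtP.
Qed.

Lemma mu_s_le u v : v \in Ns G u -> mu_s G u <= mu G u v.
Proof.
move=> Nv; rewrite /mu_s ifN; last by apply/set0Pn; exists v.
exact: bigmin_le_cond.
Qed.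

Lemma mu_s_set1 u v : Ns G u = [set v] -> mu_s G u = mu G u v.
Proof.
move=> Nu; rewrite /mu_s Nu big_set1E ifN.
  (* The default value 1 survives in the minimum over a singleton and is absorbed by [mu_le1]. *)
  by apply/min_idPl/mu_le1.
by apply/set0Pn; exists v; rewrite inE.
Qed.

Lemma mu_s_le_degree u : mu_s G u <= degree u.
Proof.
have [N0|[v Nv]] := set_0Vmem (Ns G u).
  by rewrite /mu_s N0 eqxx sumr_ge0 // => v _; apply: mu_ge0.
exact: le_trans (mu_s_le _ _ Nv) (mu_le_degree u v).
Qed.

(** A strong neighbor [w] exists, since otherwise [mu_s G u] would be 0 while the degree is
    positive. Then [degree u] is at most [mu G u w], which leaves no weight for a second edge at
    [u]. *)
Lemma mu_s_eq_degree u v :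
  mu_s G u = degree u -> 0 < mu G u v -> Ns G u = [set v].
Proof.
move=> mu_sE mu_gt0.
have [N0|[w Nw]] := set_0Vmem (Ns G u).
  have := lt_le_trans mu_gt0 (mu_le_degree u v).
  by rewrite -mu_sE /mu_s N0 eqxx ltxx.
have only_w x : 0 < mu G u x -> x = w.
  move=> mux; apply/eqP/negPn/negP => xw.
  have := mu_s_le _ _ Nw; rewrite mu_sE /degree (bigD1 w) //= (bigD1 x) //=.
  rewrite gerDl leNgt ltr_wpDr // sumr_ge0 // => y _; exact: mu_ge0.
apply/setP => x; rewrite !inE (only_w v) //.
apply/idP/eqP => [/strong_edge_gt0/only_w //|->].
by move: Nw; rewrite inE.
Qed.

Lemma weight_one : weight G (Defs.one_fun V) = \sum_u mu_s G u.
Proof. by apply: eq_bigr => u _; rewrite ffunE mul1r. Qed.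

Lemma gamma_snR_eq_mu_s :
  gamma_snR G = 2 * fsize G -> forall u, mu_s G u = degree u.
Proof.
rewrite mulr2_fsize => gammaE u.
have le_gamma := (gamma_snRP G).2 _ (is_SNRDF_one G).
have : \sum_u (degree u - mu_s G u) <= 0.
  by rewrite sumrB subr_le0 -weight_one -gammaE.
have diff_ge0 v : 0 <= degree v - mu_s G v by rewrite subr_ge0 mu_s_le_degree.
(* A sum of nonnegative terms that is at most 0 has only zero terms. *)
rewrite le_eqVlt ltNge sumr_ge0 // orbF psumr_eq0 //.
by move=> /allP/(_ u (mem_index_enum _)); rewrite subr_eq0 => /eqP.
Qed.

Section StrongMatching.
(** This packs two conditions into one: each edge is strong, and no two edges share an endpoint. *)
Hypothesis NsE : forall u v, 0 < mu G u v -> Ns G u = [set v].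

Lemma matching_mu_s u : mu_s G u = degree u.
Proof.
have [v mu_gt0|no_edge] := pickP (fun v => 0 < mu G u v).
  rewrite (mu_s_set1 _ v (NsE _ _ mu_gt0)) /degree (bigD1 v) //= big1 ?addr0 //.
  move=> w wv; apply/eqP; rewrite eq_le mu_ge0 andbT leNgt.
  apply: contra wv => /NsE; rewrite (NsE _ _ mu_gt0) => /set1_inj ->.
  exact: eqxx.
rewrite /degree big1 => [|v _]; last first.
  by apply/eqP; rewrite eq_le mu_ge0 andbT leNgt no_edge.
rewrite /mu_s ifT //; apply/eqP/setP => v; rewrite !inE.
by apply/negP => /strong_edge_gt0; rewrite no_edge.
Qed.

(** An end with value 0 has the other end as its only strong neighbor, which must then carry 2;
    otherwise both ends carry at least 1. *)
Lemma matching_SNRDF_edge f u v :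
  is_SNRDF G f -> 0 < mu G u v -> (2 <= f u + f v)%N.
Proof.
move=> /forallP f_dom.
have dom x y : 0 < mu G x y -> f x = 0%N :> nat -> f y = 2%N :> nat.
  move=> mu_gt0 fx0; have := f_dom x; rewrite fx0 eqxx /= => /exists_inP[w].
  by rewrite (NsE _ _ mu_gt0) inE => /eqP -> /eqP.
move=> mu_gt0; have mu_gt0' : 0 < mu G v u by rewrite mu_sym.
case fu: (nat_of_ord (f u)) => [|a]; first by rewrite (dom u v).
case fv: (nat_of_ord (f v)) => [|b]; last by rewrite addSn addnS.
by rewrite -fu (dom v u).
Qed.

Lemma matching_weight_ge f : is_SNRDF G f -> 2 * fsize G <= weight G f.
Proof.
(* Doubling both sides lets the weight be written once with [f u] and once with [f v], so that the
   comparison holds term by term over ordered pairs. *)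
move=> f_dom; rewrite mulr2_fsize -(ler_pM2l (ltr0Sn R 1)).
have weightE : weight G f = \sum_u \sum_v (f u)%:R * mu G u v.
  by apply: eq_bigr => u _; rewrite matching_mu_s mulr_sumr.
have weightE' : weight G f = \sum_u \sum_v (f v)%:R * mu G u v.
  rewrite weightE exchange_big.
  by apply: eq_bigr => u _; apply: eq_bigr => v _; rewrite mu_sym.
rewrite [leRHS]mulr_natl [leRHS]mulr2n {1}weightE weightE'
        -big_split /= mulr_sumr.
apply: ler_sum => u _; rewrite -big_split /= mulr_sumr.
apply: ler_sum => v _; rewrite -mulrDl -natrD.
have [mu_gt0|mu_le0] := ltP 0 (mu G u v).
  by rewrite ler_pM2r // ler_nat matching_SNRDF_edge.
have -> : mu G u v = 0 by apply/eqP; rewrite eq_le mu_le0 mu_ge0.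
by rewrite !mulr0.
Qed.

Lemma matching_gamma_snR : gamma_snR G = 2 * fsize G.
Proof.
apply/eqP; rewrite eq_le; apply/andP; split.
  apply: le_trans ((gamma_snRP G).2 _ (is_SNRDF_one G)) _.
  by rewrite weight_one mulr2_fsize ler_sum // => u _; apply: mu_s_le_degree.
by have [[f f_dom ->] _] := gamma_snRP G; apply: matching_weight_ge.
Qed.

End StrongMatching.

End FuzzyGraphTheory.

Theorem proposition3p10 (R : realType) (V : finType) (G : fuzzyGraph R V) :
  nontrivial G ->
  (gamma_snR G = 2 * fsize G <->
   (forall u v : V, is_edge G u v -> strong_edge G u v) /\
   (forall u : V, isolated G u \/ exists! v : V, v \in Ns G u)).
Proof.
move=> _; split=> [/gamma_snR_eq_mu_s mu_sE|[all_strong unique_nbr]].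
  have NsE u v : 0 < mu G u v -> Ns G u = [set v] by apply: mu_s_eq_degree.
  split=> [u v|u].
    by rewrite is_edgeE => /NsE/setP/(_ v); rewrite !inE eqxx.
  have [v /NsE Nu|no_edge] := pickP (fun v => 0 < mu G u v).
    by right; exists v; rewrite Nu; split=> [|w]; rewrite inE // => /eqP.
  by left=> v _; apply/eqP; rewrite eq_le mu_ge0 andbT leNgt no_edge.
apply: matching_gamma_snR => u v mu_gt0.
have Nv : v \in Ns G u by rewrite inE all_strong // is_edgeE.
case: (unique_nbr u) => [iso|[w [_ w_uniq]]].
  (* Isolation says nothing about [v = u], where [mu_irr] contradicts the positive weight
     instead. *)
  move: (mu_gt0); have [->|/iso ->] := eqVneq v u; rewrite ?mu_irr ltxx //.
apply/setP => x; rewrite in_set1; apply/idP/eqP => [Nx|-> //].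
by rewrite -(w_uniq x Nx) -(w_uniq v Nv).
Qed.
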